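(* Let $S\subseteq E^n$ and let $A=\{a_1,\dots,a_k\}\subseteq S$ with $k\geq 1$. Then $$D(S)=\sum_{f\in M(A)} D\bigl(S-S_{A,(f(a_1),\dots,f(a_k))}\bigr),$$ a sum with exactly $D(A)=|M(A)|$ terms.
   Context: $E=\{0,1\}$ with $0\leq 1$. $E^n$ is the set of $n$-tuples $a=(a^1,\dots,a^n)$ with $a^i\in E$, ordered componentwise: $a\leq b$ iff $a^i\leq b^i$ for all $i$. A monotone Boolean function is a map $f:E^n\to E$ with $a\leq b\Rightarrow f(a)\leq f(b)$. For $S\subseteq E^n$, $M(S)$ denotes the set of all distinct restrictions $f|_S$ of monotone Boolean functions $f:E^n\to E$ to $S$, and $D(S)=|M(S)|$ (the local Dedekind number on $S$); for $f\in M(A)$ the values $f(a_i)$ are those of the restriction. For $a\in E^n$: $S_{a,1}=\{b\in E^n: b\geq a\}$ and $S_{a,0}=\{b\in E^n: b\leq a\}$. For $A=\{a_1,\dots,a_k\}\subseteq E^n$ and $y=(y^1,\dots,y^k)\in E^k$: $S_{A,y}=\bigcup_{i=1}^k S_{a_i,y^i}$. *)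

(* Defs.v *)
From mathcomp Require Import all_boot all_order.
Set Implicit Arguments.
Unset Strict Implicit.
Unset Printing Implicit Defensive.

Local Open Scope order_scope.

(* E^n: n-tuples of booleans (false <= true); on [tupleprod] the library
   order [<=] is the componentwise one, cf. [leEtprod]. *)
Notation E n := (n.-tupleprod bool).

Definition monotoneb (n : nat) (f : {ffun E n -> bool}) : bool :=
  [forall a : E n, forall b : E n, (a <= b) ==> (f a <= f b)].

Definition restr (n : nat) (S : {set E n}) (f : {ffun E n -> bool}) :
    {ffun {x : E n | x \in S} -> bool} :=
  [ffun x => f (val x)].

Definition M (n : nat) (S : {set E n}) :
    {set {ffun {x : E n | x \in S} -> bool}} :=
  [set restr S f | f : {ffun E n -> bool} & monotoneb f].

Definition D (n : nat) (S : {set E n}) : nat := #|M S|.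

Definition Spt (n : nat) (a : E n) (y : bool) : {set E n} :=
  if y then [set b | a <= b] else [set b | b <= a].

(* A = {a_1, ..., a_k} is carried by its enumeration a : 'I_k -> E^n. *)
Definition pts (n k : nat) (a : 'I_k -> E n) : {set E n} :=
  [set a i | i : 'I_k].

Definition SAy (n k : nat) (a : 'I_k -> E n) (y : E k) : {set E n} :=
  \bigcup_(i < k) Spt (a i) (tnth y i).

Lemma mem_pts (n k : nat) (a : 'I_k -> E n) (i : 'I_k) : a i \in pts a.
Proof. exact: imset_f. Qed.

(* (f(a_1), ..., f(a_k)) for f defined on A only. *)
Definition vals (n k : nat) (a : 'I_k -> E n)
    (f : {ffun {x : E n | x \in pts a} -> bool}) : E k :=
  [tuple f (exist _ (a i) (mem_pts a i)) | i < k].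

(* Main.v *)
(** Split [M S] according to the restriction [f] to [A].  The functions of [M S]
    restricting to a given [f] are forced on the part of [S] above a point of [A]
    where [f] is 1 or below a point of [A] where [f] is 0.  Elsewhere they are
    free: any monotone [h] can be overwritten by the forced values without losing
    monotonicity, so restriction to the rest of [S] is a bijection from this fibre
    onto [M (S :\: SAy a (vals f))]. *)

Require Import Defs.
From mathcomp Require Import all_boot all_order.

Import Order.TTheory.

Set Implicit Arguments.
Unset Strict Implicit.
Unset Printing Implicit Defensive.

Lemma monotonebP (n : nat) (f : {ffun E n -> bool}) :
  reflect (forall x y : E n, (x <= y)%O -> f x -> f y) (monotoneb f).
Proof.
apply: (iffP 'forall_forallP) => fm x y.
  by move=> xy; have := fm x y; rewrite xy leEbool; case: (f x); case: (f y).
by apply/implyP => /fm; rewrite leEbool; case: (f x) => // ->.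
Qed.

Lemma restrP (n : nat) (S : {set E n}) (f g : {ffun E n -> bool}) :
  restr S f = restr S g <-> {in S, f =1 g}.
Proof.
split=> [/ffunP fg x xS|fg]; first by have := fg (exist _ x xS); rewrite !ffunE.
by apply/ffunP => x; rewrite !ffunE fg ?(valP x).
Qed.

(** Members of [M S] live on a subtype, so restricting them further needs its own map. It both cuts
    [M S] into fibres and carries each fibre to the rest of [S]. *)
Definition sub_restr (n : nat) (S T : {set E n}) (TS : T \subset S)
    (f : {ffun {x : E n | x \in S} -> bool}) :
    {ffun {x : E n | x \in T} -> bool} :=
  [ffun x => f (exist _ (val x) (subsetP TS _ (valP x)))].

Lemma sub_restrE (n : nat) (S T : {set E n}) (TS : T \subset S)
    (f : {ffun E n -> bool}) :
  sub_restr TS (restr S f) = restr T f.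
Proof. by apply/ffunP => x; rewrite !ffunE. Qed.

Section Overwrite.

Variables (n k : nat) (a : 'I_k -> E n).

Lemma vals_restr (g : {ffun E n -> bool}) (i : 'I_k) :
  tnth (vals (restr (pts a) g)) i = g (a i).
Proof. by rewrite tnth_mktuple ffunE. Qed.

Lemma SAyP (y : E k) (x : E n) :
  reflect (exists i, if tnth y i then (a i <= x)%O else (x <= a i)%O)
          (x \in SAy a y).
Proof.
apply: (iffP bigcupP) => [[i _]|[i xi]]; last exists i => //; last move: xi.
  by rewrite /Spt => xi; exists i; move: xi; case: ifP; rewrite inE.
by rewrite /Spt; case: ifP; rewrite inE.
Qed.

(** A witness [a i] pins both functions at [x]: a common 1 propagates upward, a common 0
    downward. *)
Lemma monotone_forced (f g : {ffun E n -> bool}) (x : E n) :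
    monotoneb f -> monotoneb g -> {in pts a, f =1 g} ->
  x \in SAy a (vals (restr (pts a) f)) -> f x = g x.
Proof.
move=> /monotonebP fm /monotonebP gm fg /SAyP[i].
rewrite vals_restr; have := fg _ (mem_pts a i).
case fai: (f (a i)) => gai xi.
  by rewrite (fm _ _ xi fai) (gm _ _ xi (esym gai)).
by rewrite (contraFF (fm _ _ xi) fai) (contraFF (gm _ _ xi) (esym gai)).
Qed.

Definition overwrite (g h : {ffun E n -> bool}) : {ffun E n -> bool} :=
  [ffun x => if x \in SAy a (vals (restr (pts a) g)) then g x else h x].

Lemma overwrite_monotone (g h : {ffun E n -> bool}) :
  monotoneb g -> monotoneb h -> monotoneb (overwrite g h).
Proof.
move=> gm /monotonebP hm; move/monotonebP: (gm) => gP.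
apply/monotonebP => x y xy; rewrite !ffunE.
case: ifP => xS; case: ifP => yS; first exact: gP.
(* Only [x] is forced: its witness has value 0, since a 1 would force [y] too, so [g x] is 0. *)
- move: xS => /SAyP[i]; rewrite vals_restr; case: ifP => gi xi gx.
    by case/SAyP: yS; exists i; rewrite vals_restr gi (le_trans xi xy).
  by rewrite (gP _ _ xi gx) in gi.
(* Dually, the witness of [y] has value 1, so [g y] is 1. *)
- move=> hx; case/SAyP: yS => i; rewrite vals_restr; case: ifP => gi yi.
    exact: gP gi.
  by case/SAyP: xS; exists i; rewrite vals_restr gi (le_trans xy yi).
- exact: hm.
Qed.

(** By reflexivity [a i] lies in its own cone for either bit; hence overwriting keeps [g] on all of
    [pts a]. *)
Lemma pts_sub_SAy (y : E k) : pts a \subset SAy a y.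
Proof.
by apply/subsetP => _ /imsetP[i _ ->]; apply/SAyP; exists i; rewrite lexx if_same.
Qed.

Lemma card_fibre (S : {set E n}) (hA : pts a \subset S)
    (f : {ffun {x : E n | x \in pts a} -> bool}) :
    f \in M (pts a) ->
  #|[set u in M S | sub_restr hA u == f]| = D (S :\: SAy a (vals f)).
Proof.
case/imsetP=> g; rewrite inE => gm ->{f}.
set U := S :\: _; have US : U \subset S by exact: subsetDl.
(* Injectivity on the fibre: off [U], the values on [S] are forced by those on [pts a], which all
   members share. *)
rewrite /D -(card_in_imset (f := sub_restr US)); last first.
  move=> _ _ /setIdP[/imsetP[u um ->] +] /setIdP[/imsetP[v vm ->] +].
  rewrite !inE in um vm; rewrite !sub_restrE.
  move=> /eqP ug /eqP vg /restrP uvU; apply/restrP => x xS.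
  case xA: (x \in SAy a (vals (restr (pts a) g))); last first.
    by apply: uvU; rewrite inE xA.
  by apply: monotone_forced => //; [apply/restrP; rewrite vg | rewrite ug].
apply: eq_card => w; apply/imsetP/imsetP => [[_ /setIdP[/imsetP[u um ->] _] ->]|].
  by exists u => //; rewrite sub_restrE.
(* The preimage of [restr U h] agrees with [g] on [pts a], hence lies in the fibre, and with [h] on
   [U]. *)
case=> h; rewrite inE => hm ->; exists (restr S (overwrite g h)).
  rewrite inE sub_restrE; apply/andP; split.
    by apply: imset_f; rewrite inE overwrite_monotone.
  apply/eqP/restrP => x xA.
  by rewrite ffunE (subsetP (pts_sub_SAy _) _ xA).
by rewrite sub_restrE; apply/restrP => x; rewrite inE ffunE => /andP[/negbTE ->].
Qed.

End Overwrite.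

Theorem theorem1 (n k : nat) (S : {set E n}) (a : 'I_k -> E n)
    (hk : 0 < k) (hA : pts a \subset S) :
  D S = \sum_(f in M (pts a)) D (S :\: SAy a (vals f))
  /\ \sum_(f in M (pts a)) 1 = D (pts a).
Proof.
split; last by rewrite sum1_card.
rewrite {1}/D -sum1_card (partition_big (sub_restr hA) (mem (M (pts a)))) /=.
  by apply: eq_bigr => f fM; rewrite -(card_fibre hA fM) -sum1_card;
    apply: eq_bigl => u; rewrite inE.
(* Every fibre index is in [M (pts a)]: the same monotone [g] induces both restrictions. *)
by move=> _ /imsetP[g gm ->]; rewrite sub_restrE; apply: imset_f.
Qed.
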